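(* Let $A\in\mathbb{C}^{n\times n}$, let $\|\cdot\|$ be an arbitrary vector norm on $\mathbb{C}^n$ (with induced matrix norm also denoted $\|\cdot\|$), let $y_0\in\mathbb{C}^n\setminus\{0\}$ and let $\hat z_0\in\mathbb{C}^n$ with $\|\hat z_0\|=1$. Assume that both $y_0$ and $\hat z_0$ satisfy the RLGE condition. Then, as $t\to+\infty$, $$K(t,y_0,\hat z_0)\sim \frac{\|Q_1(t)\hat z_0\|}{\|Q_1(t)\hat y_0\|}\qquad\text{and}\qquad K(t,y_0)\sim \frac{\|Q_1(t)\|}{\|Q_1(t)\hat y_0\|}.$$
   Context: Notation: $\hat y_0=y_0/\|y_0\|$. For $t\in\mathbb{R}$ and unit $\hat z_0$, the directional condition number is $K(t,y_0,\hat z_0)=\|e^{tA}\hat z_0\|/\|e^{tA}\hat y_0\|$ and the condition number is $K(t,y_0)=\max_{\|\hat z_0\|=1}K(t,y_0,\hat z_0)=\|e^{tA}\|/\|e^{tA}\hat y_0\|$. Let $\lambda_1,\dots,\lambda_p$ be the distinct eigenvalues of $A$, $\omega_i=\operatorname{Im}\lambda_i$. Fix a Jordan basis $v^{(i,j,k)}$, $i\in\{1,\dots,p\}$, $j\in\{1,\dots,d_i\}$ ($d_i$ the geometric multiplicity of $\lambda_i$), $k\in\{1,\dots,m_{ij}\}$, consisting of Jordan chains: $(A-\lambda_iI)v^{(i,j,1)}=0$ and $(A-\lambda_iI)v^{(i,j,k)}=v^{(i,j,k-1)}$ for $k\ge 2$. Let $V$ be the matrix whose columns are the $v^{(i,j,k)}$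 ordered lexicographically in $(i,j,k)$, and let $w^{(i,j,k)}$ be the rows of $V^{-1}$ in the same order. For $u\in\mathbb{C}^n$, $\alpha_{ijk}(u)=w^{(i,j,k)}u$ is the component of $u$ along $v^{(i,j,k)}$. $\Lambda_1$ denotes the set of eigenvalues of $A$ with maximal real part, and $M_1=\max_{\lambda_i\in\Lambda_1}\max_{j}m_{ij}$. Define $$Q_1(t)=\sum_{\lambda_i\in\Lambda_1,\ j\in\{1,\dots,d_i\},\ m_{ij}=M_1} e^{\sqrt{-1}\,\omega_i t}\,v^{(i,j,1)}w^{(i,j,M_1)}\in\mathbb{C}^{n\times n}.$$ A vector $u\in\mathbb{C}^n$ satisfies the Rightmost Last Generalized Eigenvectors (RLGE) condition if $\alpha_{ijM_1}(u)\neq 0$ for some $(i,j)$ with $\lambda_i\in\Lambda_1$ and $m_{ij}=M_1$. Asymptotic equivalence: $a(t)\sim b(t)$ as $t\to+\infty$ means $\lim_{t\to+\infty}a(t)/b(t)=1$. *)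

(* Defs.v *)
From mathcomp Require Import all_boot all_order all_algebra.
From mathcomp Require Import all_classical all_reals all_analysis.
From mathcomp Require Export complex.
Import numFieldNormedType.Exports.
Import Order.TTheory GRing.Theory Num.Theory.

Set Implicit Arguments.
Unset Strict Implicit.
Unset Printing Implicit Defensive.

Local Open Scope ring_scope.
Local Open Scope classical_set_scope.

Definition cabs {R : realType} (z : R[i]) : R := Normc.normc z.

Definition cofr {R : realType} (x : R) : R[i] := Complex x 0.

Definition is_vnorm {R : realType} {n : nat} (N : 'cV[R[i]]_n -> R) : Prop :=
  [/\ forall x, 0 <= N x,
      forall x, N x = 0 -> x = 0,
      forall (a : R[i]) x, N (a *: x) = cabs a * N x &
      forall x y, N (x + y) <= N x + N y].

Definition opnorm {R : realType} {n : nat} (N : 'cV[R[i]]_n -> R)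
  (M : 'M[R[i]]_n) : R :=
  sup [set N (M *m z) | z in [set z | N z = 1]].

Definition expm_partial {R : realType} {n : nat} (t : R) (A : 'M[R[i]]_n)
  (K : nat) : 'M[R[i]]_n :=
  \sum_(k < K) (cofr (t ^+ k / (k`!)%:R) *: A ^+ k).

Definition expm {R : realType} {n : nat} (t : R) (A : 'M[R[i]]_n)
  : 'M[R[i]]_n :=
  \matrix_(i, j) Complex (limn (fun K => @complex.Re R (expm_partial t A K i j)))
                         (limn (fun K => @complex.Im R (expm_partial t A K i j))).

Definition cexpi {R : realType} (theta : R) : R[i] :=
  Complex (cos theta) (sin theta).

Definition nrmlz {R : realType} {n : nat} (N : 'cV[R[i]]_n -> R)
  (y : 'cV[R[i]]_n) : 'cV[R[i]]_n := cofr (N y)^-1 *: y.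

Definition Kdir {R : realType} {n : nat} (N : 'cV[R[i]]_n -> R)
  (A : 'M[R[i]]_n) (y0 z0 : 'cV[R[i]]_n) (t : R) : R :=
  N (expm t A *m z0) / N (expm t A *m nrmlz N y0).

Definition Kcond {R : realType} {n : nat} (N : 'cV[R[i]]_n -> R)
  (A : 'M[R[i]]_n) (y0 : 'cV[R[i]]_n) (t : R) : R :=
  opnorm N (expm t A) / N (expm t A *m nrmlz N y0).

(* ---------- Jordan basis ----------
   A Jordan basis is encoded by an invertible matrix V whose columns are the
   basis vectors, together with, for each column c:
     lam c : the eigenvalue of the Jordan chain containing column c,
     ch  c : an identifier of the Jordan chain containing column c,
     pos c : the position k (1-based) of column c in its chain.
   The columns of a chain occupy exactly the positions 1..m (m = chain
   length), and the chain relations hold. The rows of V^{-1} (invmx V) are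
   the w's, indexed consistently with the columns of V. *)

Definition chain_len {n : nat} (ch : 'I_n -> 'I_n) (c : 'I_n) : nat :=
  #|[set c' | ch c' == ch c]|.

Definition is_jordan_basis {R : realType} {n : nat} (A V : 'M[R[i]]_n)
  (lam : 'I_n -> R[i]) (ch : 'I_n -> 'I_n) (pos : 'I_n -> nat) : Prop :=
  [/\ V \in unitmx,
      forall c c', ch c = ch c' -> lam c = lam c',
      forall c, (1 <= pos c <= chain_len ch c)%N,
      forall c c', ch c = ch c' -> pos c = pos c' -> c = c' &
      forall c,
        if pos c == 1%N then (A - (lam c)%:M) *m col c V = 0
        else exists c', [/\ ch c' = ch c, pos c' = (pos c).-1 &
                            (A - (lam c)%:M) *m col c V = col c' V]].

Definition inL1 {R : realType} {n : nat} (lam : 'I_n -> R[i]) (c : 'I_n)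
  : bool :=
  [forall c', complex.Re (lam c') <= complex.Re (lam c)].

Definition M1 {R : realType} {n : nat} (lam : 'I_n -> R[i])
  (ch : 'I_n -> 'I_n) : nat :=
  \max_(c | inL1 lam c) chain_len ch c.

(* column c is v^{(i,j,M_1)} for some (i,j) with lambda_i in Lambda_1 and
   m_ij = M_1 *)
Definition top_col {R : realType} {n : nat} (lam : 'I_n -> R[i])
  (ch : 'I_n -> 'I_n) (pos : 'I_n -> nat) (c : 'I_n) : bool :=
  [&& inL1 lam c, chain_len ch c == M1 lam ch & pos c == M1 lam ch].

Definition chain_head {n : nat} (ch : 'I_n -> 'I_n) (pos : 'I_n -> nat)
  (c : 'I_n) : 'I_n :=
  odflt c [pick c' | (ch c' == ch c) && (pos c' == 1%N)].

Definition Q1 {R : realType} {n : nat} (V : 'M[R[i]]_n)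
  (lam : 'I_n -> R[i]) (ch : 'I_n -> 'I_n) (pos : 'I_n -> nat) (t : R)
  : 'M[R[i]]_n :=
  \sum_(c | top_col lam ch pos c)
     cexpi (complex.Im (lam c) * t) *: (col (chain_head ch pos c) V *m row c (invmx V)).

(* Rightmost Last Generalized Eigenvectors condition *)
Definition RLGE {R : realType} {n : nat} (V : 'M[R[i]]_n)
  (lam : 'I_n -> R[i]) (ch : 'I_n -> 'I_n) (pos : 'I_n -> nat)
  (u : 'cV[R[i]]_n) : Prop :=
  exists c, top_col lam ch pos c /\ row c (invmx V) *m u != 0.

Definition asym_equiv {R : realType} (a b : R -> R) : Prop :=
  (a t / b t) @[t --> +oo] --> (1 : R).

(* Main.v *)
(** Expanding u = \sum_c alpha_c(u) v_c in the Jordan basis,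
    e^{tA} v_c = \sum_j (t^j / j!) e^{lam_c t} (A - lam_c)^j v_c.
    Divided by s(t) = t^(M_1-1) / (M_1-1)! e^{r t}, with r the maximal real part,
    every term is O(1/t) except the one with j = M_1 - 1 on a chain of length M_1
    in Lambda_1, which is exactly e^{i omega t} v^{(i,j,1)}.  Hence
    N(e^{tA} u - s(t) Q_1(t) u) <= s(t) (K / t) N(u) uniformly in u, which handles
    vectors and the operator norm at once.  Under RLGE, a coordinate of Q_1(t) u
    along some chain head has constant nonzero modulus, so N(Q_1(t) u) is bounded
    away from 0 and the quotients tend to 1. *)
Require Import Defs.
From mathcomp Require Import all_boot all_order all_algebra.
From mathcomp Require Import all_classical all_reals all_analysis.
From mathcomp Require Import complex.
From mathcomp Require Import ring zify.
Import Order.TTheory GRing.Theory Num.Theory.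
Import numFieldNormedType.Exports.
Local Open Scope classical_set_scope.
Local Open Scope ring_scope.

Set Implicit Arguments.
Unset Strict Implicit.
Unset Printing Implicit Defensive.

(** * The modulus of complex numbers *)

Section ComplexModulus.
Variable R : realType.
Implicit Types z w : R[i].

Lemma cabs_ge0 z : 0 <= cabs z.
Proof. by case: z => a b; apply: sqrtr_ge0. Qed.

Lemma cabs0 : cabs (0 : R[i]) = 0.
Proof. exact: Normc.normc0. Qed.

Lemma cabs1 : cabs (1 : R[i]) = 1.
Proof. exact: Normc.normc1. Qed.

Lemma cabs_eq0 z : (cabs z == 0) = (z == 0).
Proof.
by apply/eqP/eqP => [/Normc.eq0_normc//|->]; exact: cabs0.
Qed.

Lemma cabsM z w : cabs (z * w) = cabs z * cabs w.
Proof. exact: Normc.normcM. Qed.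

Lemma cabsV z : cabs z^-1 = (cabs z)^-1.
Proof. exact: Normc.normcV. Qed.

Lemma cabsX z k : cabs (z ^+ k) = cabs z ^+ k.
Proof. by elim: k => [|k IH]; rewrite ?cabs1 // !exprS cabsM IH. Qed.

Lemma cabsN z : cabs (- z) = cabs z.
Proof. exact: normcN. Qed.

Lemma cabsD z w : cabs (z + w) <= cabs z + cabs w.
Proof. exact: le_normcD. Qed.

Lemma cabs_sum I (r : seq I) (P : pred I) (F : I -> R[i]) :
  cabs (\sum_(i <- r | P i) F i) <= \sum_(i <- r | P i) cabs (F i).
Proof.
elim/big_ind2: _ => [|x a y b ha hb|//]; first by rewrite cabs0.
by rewrite (le_trans (cabsD _ _)) // lerD.
Qed.

Lemma cofrE (x : R) : cofr x = real_complex R x.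
Proof. by []. Qed.

Lemma cabs_cofr (x : R) : cabs (cofr x) = `|x|.
Proof. by rewrite /cabs /= expr0n addr0 sqrtr_sqr. Qed.

Lemma cabs_nat k : cabs (k%:R : R[i]) = k%:R.
Proof.
have -> : k%:R = cofr k%:R :> R[i] by rewrite cofrE rmorph_nat.
by rewrite cabs_cofr normr_nat.
Qed.

Lemma cabs_cexpi (x : R) : cabs (cexpi x) = 1.
Proof. by rewrite /cabs /= cos2Dsin2 sqrtr1. Qed.

Lemma ler_Re_cabs z : `|complex.Re z| <= cabs z.
Proof.
by case: z => a b /=; rewrite -sqrtr_sqr ler_wsqrtr // lerDl sqr_ge0.
Qed.

Lemma ler_Im_cabs z : `|complex.Im z| <= cabs z.
Proof.
by case: z => a b /=; rewrite -sqrtr_sqr ler_wsqrtr // lerDr sqr_ge0.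
Qed.

End ComplexModulus.

(** * Complex limits, taken by real and imaginary parts as in [expm] *)

Definition ccvg {R : realType} (u : nat -> R[i]) (l : R[i]) : Prop :=
  (complex.Re (u k) @[k --> \oo] --> complex.Re l) /\
  (complex.Im (u k) @[k --> \oo] --> complex.Im l).

Section ComplexSequences.
Variable R : realType.
Implicit Types (u v : nat -> R[i]) (l m : R[i]).

Lemma ccvg_cst l : ccvg (fun=> l) l.
Proof. by split; exact: cvg_cst. Qed.

Lemma complex_ReD (z w : R[i]) : complex.Re (z + w) = complex.Re z + complex.Re w.
Proof. by case: z w => [a b] [c d]. Qed.

Lemma complex_ImD (z w : R[i]) : complex.Im (z + w) = complex.Im z + complex.Im w.
Proof. by case: z w => [a b] [c d]. Qed.

Lemma complex_ReM (z w : R[i]) : complex.Re (z * w) =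
  complex.Re z * complex.Re w - complex.Im z * complex.Im w.
Proof. by case: z w => [a b] [c d]. Qed.

Lemma complex_ImM (z w : R[i]) : complex.Im (z * w) =
  complex.Re z * complex.Im w + complex.Im z * complex.Re w.
Proof. by case: z w => [a b] [c d]. Qed.

Lemma ccvgD u v l m : ccvg u l -> ccvg v m -> ccvg (fun k => u k + v k) (l + m).
Proof.
move=> [u1 u2] [v1 v2]; split; rewrite ?complex_ReD ?complex_ImD.
  by under eq_cvg do rewrite complex_ReD; exact: cvgD.
by under eq_cvg do rewrite complex_ImD; exact: cvgD.
Qed.

Lemma ccvgM u v l m : ccvg u l -> ccvg v m -> ccvg (fun k => u k * v k) (l * m).
Proof.
move=> [u1 u2] [v1 v2]; split; rewrite ?complex_ReM ?complex_ImM.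
  by under eq_cvg do rewrite complex_ReM; apply: cvgB; exact: cvgM.
by under eq_cvg do rewrite complex_ImM; apply: cvgD; exact: cvgM.
Qed.

Lemma ccvg_sum I (r : seq I) (P : pred I) (u : I -> nat -> R[i]) (l : I -> R[i]) :
  (forall i, ccvg (u i) (l i)) ->
  ccvg (fun k => \sum_(i <- r | P i) u i k) (\sum_(i <- r | P i) l i).
Proof.
move=> h; elim: r => [|i r IH].
  rewrite big_nil (_ : (fun _ => _) = fun=> 0); first exact: ccvg_cst.
  by apply/funext => k; rewrite big_nil.
rewrite big_cons (_ : (fun _ => _) = fun k =>
  if P i then u i k + \sum_(j <- r | P j) u j k else \sum_(j <- r | P j) u j k).
  by case: (P i) => //; exact: ccvgD.
by apply/funext => k; rewrite big_cons.
Qed.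

(** The real and imaginary parts of [u - v] are dominated by its modulus, hence tend to 0; then
    [v = u - (u - v)]. *)
Lemma ccvg_dist0 u v l : ccvg u l ->
  (cabs (u k - v k) @[k --> \oo] --> (0 : R)) -> ccvg v l.
Proof.
move=> ul uv.
have H (f : R[i] -> R) : (forall z, `|f z| <= cabs z) ->
  f (u k - v k) @[k --> \oo] --> (0 : R).
  move=> hf; apply/cvgr0Pnorm_lt => e e0.
  have /cvgr0Pnorm_lt /(_ e e0) := uv; apply: filterS => k.
  by rewrite [in X in X -> _]ger0_norm ?cabs_ge0 //; exact: le_lt_trans.
have H1 := H _ (@ler_Re_cabs R); have H2 := H _ (@ler_Im_cabs R).
case: ul => ul1 ul2; split.
  rewrite -[complex.Re l]subr0.
  rewrite (_ : (fun k => complex.Re (v k)) =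
    (fun k => complex.Re (u k)) - (fun k => complex.Re (u k - v k)));
    first exact: cvgB.
  apply/funext => k; rewrite !fctE.
  by case: (u k) (v k) => [a b] [c d] /=; rewrite opprB addrC subrK.
rewrite -[complex.Im l]subr0.
  rewrite (_ : (fun k => complex.Im (v k)) =
    (fun k => complex.Im (u k)) - (fun k => complex.Im (u k - v k)));
    first exact: cvgB.
apply/funext => k; rewrite !fctE.
by case: (u k) (v k) => [a b] [c d] /=; rewrite opprB addrC subrK.
Qed.

Lemma ccvg_shift u l (m : nat) : ccvg u l -> ccvg (fun k => u (k - m)%N) l.
Proof.
have H (f : nat -> R) (x : R) :
    f k @[k --> \oo] --> x -> f (k - m)%N @[k --> \oo] --> x.
  move=> fx; rewrite -(cvg_shiftn m) /=.
  by under eq_cvg do rewrite addnK.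
by move=> [u1 u2]; split; [exact: (H (fun k => complex.Re (u k)))|
                           exact: (H (fun k => complex.Im (u k)))].
Qed.

End ComplexSequences.

(** * Truncated exponential series and their Cauchy product *)

Definition expsum {F : fieldType} (z : F) (K : nat) : F :=
  \sum_(k < K) z ^+ k / k`!%:R.

(** The binomial theorem, reindexed by [k = i + j], gives a sum over the triangle [i + j < K]. *)
Lemma expsum_addE (F : numFieldType) (a b : F) K :
  expsum (a + b) K =
  \sum_(i < K) \sum_(0 <= j < K - i) (a ^+ i / i`!%:R) * (b ^+ j / j`!%:R).
Proof.
rewrite /expsum.
transitivity (\sum_(k < K) \sum_(i < K | (i <= k)%N)
    (a ^+ i / i`!%:R) * (b ^+ (k - i) / (k - i)`!%:R)).
  apply: eq_bigr => k _; rewrite addrC exprDn_comm; last exact: mulrC.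
  rewrite mulr_suml (big_ord_widen_cond K xpredT
    (fun i => (b ^+ (k - i) * a ^+ i) *+ 'C(k, i) / k`!%:R)) //.
  apply: eq_big => [i|i /= ik]; first by rewrite ltnS.
  rewrite ltnS in ik; rewrite -mulr_natr -(bin_fact ik) !natrM.
  have fN0 (j : nat) : (j`!%:R : F) != 0 by rewrite pnatr_eq0 -lt0n fact_gt0.
  have bN0 : ('C(k, i)%:R : F) != 0 by rewrite pnatr_eq0 -lt0n bin_gt0.
  by field; rewrite !fN0 bN0.
rewrite (exchange_big_dep predT) //=; apply: eq_bigr => i _.
rewrite -(big_mkord (fun k => (i <= k)%N)
  (fun k => a ^+ i / i`!%:R * (b ^+ (k - i) / (k - i)`!%:R))).
rewrite (big_cat_nat (n := i)) ?leq0n 1?ltnW //= big_nat_cond big1 ?add0r; last first.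
  by move=> k; case/andP=> /andP[_ ki]; rewrite leqNgt ki.
rewrite -{1}[nat_of_ord i]add0n big_addn.
by apply: eq_big => k; rewrite ?leq_addl // addnK.
Qed.

(** The product runs over the square [i, j < K]; removing the triangle leaves the corner
    [i + j >= K], a form in which moduli can be compared term by term. *)
Lemma expsum_mulE (F : numFieldType) (a b : F) K :
  expsum a K * expsum b K - expsum (a + b) K =
  \sum_(i < K) \sum_(K - i <= j < K) (a ^+ i / i`!%:R) * (b ^+ j / j`!%:R).
Proof.
rewrite expsum_addE /expsum mulr_suml -sumrB; apply: eq_bigr => i _.
rewrite mulr_sumr.
rewrite -(big_mkord predT (fun j => a ^+ i / i`!%:R * (b ^+ j / j`!%:R))).
by rewrite (big_cat_nat (n := K - i)) ?leq0n ?leq_subr //= addrAC subrr add0r.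
Qed.

(** * The complex exponential as limit of its series *)

Section ComplexExponential.
Variable R : realType.

Lemma expsum_series (x : R) : expsum x = series (exp_coeff x).
Proof. by apply/funext => K; rewrite /expsum /series /= big_mkord. Qed.

Lemma cvg_expsum (x : R) : expsum x k @[k --> \oo] --> expR x.
Proof. by rewrite expsum_series; exact: is_cvg_series_exp_coeff. Qed.

Lemma expsum_cofr (x : R) K : expsum (cofr x) K = cofr (expsum x K).
Proof.
rewrite /expsum !cofrE rmorph_sum; apply: eq_bigr => k _.
by rewrite rmorphM fmorphV rmorphXn rmorph_nat.
Qed.

Lemma cvg_expsum_cofr (x : R) : ccvg (expsum (cofr x)) (cofr (expR x)).
Proof.
split => /=.
  by under eq_cvg do rewrite expsum_cofr /=; exact: cvg_expsum.
by under eq_cvg do rewrite expsum_cofr /=; exact: cvg_cst.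
Qed.

(** Even powers of [Complex 0 y] are real and odd ones imaginary, with sign [(-1) ^+ K./2]. *)
Lemma expsum_im (y : R) K : expsum (Complex 0 y) K =
  Complex (series (cos_coeff y) K) (series (sin_coeff y) K).
Proof.
rewrite /expsum /series /= !big_mkord.
elim: K => [|K IH]; first by rewrite !big_ord0.
rewrite !big_ord_recr /= IH.
have -> : Complex 0 y ^+ K / (K`!%:R : R[i]) =
   Complex (~~ odd K)%:R ((odd K)%:R) * cofr ((-1) ^+ K./2 * y ^+ K / K`!%:R).
  have -> : Complex 0 y = Complex 0 1 * cofr y.
    apply/eqP; rewrite eq_complex /=.
    by rewrite !(mul0r, mulr0, subr0, mul1r, addr0, add0r, oppr0) !eqxx.
  rewrite exprMn !cofrE !rmorphM fmorphV rmorph_nat !rmorphXn rmorphN1.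
  rewrite !mulrA; congr (_ * _ / _).
  rewrite -{1}[K]odd_double_half exprD -mul2n exprM.
  have -> : (Complex 0 1 : R[i]) ^+ 2 = -1.
    apply/eqP; rewrite expr2 eq_complex /=.
    by rewrite !(mul0r, mulr0, sub0r, mul1r, addr0, oppr0) !eqxx.
  by congr (_ * _); case: (odd K).
apply/eqP; rewrite eq_complex /=; apply/andP; split; apply/eqP.
  by rewrite mulr0 subr0 !mulrA.
rewrite mulr0 add0r; congr (_ + _); rewrite mulrA.
congr (_ / _); rewrite -!mulrA; case: (boolP (odd K)) => [oK|]; last by rewrite !mul0r.
(* [sin_coeff] uses [K.-1./2], which equals [K./2] for odd [K]. *)
by congr (_ * (_ ^+ _ * _)); rewrite -[K in K./2]prednK ?odd_gt0 //= uphalf_half;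
  case: K oK {IH} => //= k; case: odd.
Qed.

Lemma cvg_expsum_im (y : R) : ccvg (expsum (Complex 0 y)) (cexpi y).
Proof.
split => /=.
  under eq_cvg do rewrite expsum_im /=.
  by rewrite cos.unlock; exact: is_cvg_series_cos_coeff.
under eq_cvg do rewrite expsum_im /=.
by rewrite sin.unlock; exact: is_cvg_series_sin_coeff.
Qed.

(* The tail of the Cauchy product is dominated termwise by the one for the
   moduli, which tends to 0 because expR (x + y) = expR x * expR y. *)
Lemma cvg_expsum_tail (a b : R[i]) :
  cabs (expsum a k * expsum b k - expsum (a + b) k) @[k --> \oo] --> (0 : R).
Proof.
pose g k := expsum (cabs a) k * expsum (cabs b) k - expsum (cabs a + cabs b) k.
have g0 : g k @[k --> \oo] --> (0 : R).
  rewrite -[X in _ --> X](subrr (expR (cabs a + cabs b))) {1}expRD.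
  by apply: cvgB; [apply: cvgM|]; exact: cvg_expsum.
apply: (squeeze_cvgr _ (cvg_cst 0) g0).
near=> k; rewrite cabs_ge0 /= /g !expsum_mulE.
apply: le_trans (cabs_sum _ _ _) _; apply: ler_sum => i _.
apply: le_trans (cabs_sum _ _ _) _; apply: ler_sum => j _.
by rewrite !cabsM !cabsV !cabsX !cabs_nat.
Unshelve. all: by end_near. Qed.

Definition cexp (z : R[i]) : R[i] :=
  cofr (expR (complex.Re z)) * cexpi (complex.Im z).

(** The series of the real and the imaginary part converge, and the product of their partial sums
    differs from the partial sum at [z] by a tail tending to 0. *)
Lemma cvg_expsum_complex (z : R[i]) : ccvg (expsum z) (cexp z).
Proof.
have := ccvg_dist0 (ccvgM (cvg_expsum_cofr (complex.Re z))
                          (cvg_expsum_im (complex.Im z)))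
                   (cvg_expsum_tail _ _).
by rewrite (_ : cofr _ + _ = z) //; case: z => x y; rewrite /cofr;
  congr Complex; rewrite /= ?addr0 ?add0r.
Qed.

End ComplexExponential.

(** * The matrix exponential on a basis of generalized eigenvectors *)

Lemma big_ord_vanish (V : nmodType) (F : nat -> V) p q : (p <= q)%N ->
  (forall j, (p <= j)%N -> F j = 0) -> \sum_(j < q) F j = \sum_(j < p) F j.
Proof.
move=> pq F0; rewrite (big_ord_widen q F pq) [RHS]big_mkcond /=.
by apply: eq_bigr => j _; case: ltnP => // /F0.
Qed.

Section MatrixExponential.
Variables (R : realType) (n : nat).
Implicit Types (A V E : 'M[R[i]]_n) (l : R[i]) (v : 'cV[R[i]]_n).

(** Binomial expansion of [A = l + B], cut at [m] because [B ^+ m] kills [v]. *)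
Lemma exprn_mul_shift A l v m k : (A - l%:M) ^+ m *m v = 0 ->
  A ^+ k *m v =
  \sum_(j < m) (l ^+ (k - j) *+ 'C(k, j)) *: ((A - l%:M) ^+ j *m v).
Proof.
set B := A - l%:M => Bv.
have Bv0 j : (m <= j)%N -> B ^+ j *m v = 0.
  by move=> mj; rewrite -(subnK mj) exprD -mulmxE -mulmxA Bv mulmx0.
have -> : A = l%:M + B by rewrite addrC subrK.
rewrite exprDn_comm; last by rewrite /GRing.comm -!mulmxE scalar_mxC.
pose F j := (l ^+ (k - j) *+ 'C(k, j)) *: (B ^+ j *m v).
rewrite mulmx_suml; transitivity (\sum_(j < k.+1) F j).
  apply: eq_bigr => j _; rewrite /F -scalemx1 -mulmxE.
  have -> : (l *: 1%:M : 'M[R[i]]_n) ^+ (k - j) = (l ^+ (k - j)) *: 1%:M.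
    elim: (k - j)%N => [|i IH]; first by rewrite !expr0 scale1r.
    by rewrite !exprS IH -mulmxE -scalemxAl mul1mx scalerA.
  by rewrite -scalemxAl mul1mx scalerMnl -scalemxAl.
(* Both sums are extended to [k.+1 + m] terms: the added ones vanish by the binomial coefficient in
   one, by [Bv0] in the other. *)
rewrite -(big_ord_vanish (leq_addr m k.+1)); last first.
  by move=> j kj; rewrite /F bin_small ?mulr0n ?scale0r.
rewrite -(big_ord_vanish (F := F) (leq_addl k.+1 m)) // => j mj.
by rewrite /F Bv0 ?scaler0.
Qed.

(** Since ['C(k, j) / k! = 1 / (j! (k - j)!)], putting [k = i + j] takes out [t ^+ j / j!] and
    leaves a shorter exponential sum. *)
Lemma expsum_bin (t : R) l (j K : nat) :
  \sum_(k < K) cofr (t ^+ k / k`!%:R) * (l ^+ (k - j) *+ 'C(k, j)) =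
  cofr (t ^+ j / j`!%:R) * expsum (l * cofr t) (K - j).
Proof.
have [Kj|jK] := leqP K j.
  rewrite (eqP Kj) /expsum big_ord0 mulr0 big1 // => k _.
  by rewrite bin_small ?mulr0n ?mulr0 // (leq_trans _ Kj).
rewrite -(big_mkord predT
  (fun k => cofr (t ^+ k / k`!%:R) * (l ^+ (k - j) *+ 'C(k, j)))).
rewrite (big_cat_nat (n := j)) ?leq0n 1?ltnW //= big_nat_cond big1 ?add0r; last first.
  by move=> k /andP[/andP[_ kj] _]; rewrite bin_small ?mulr0n ?mulr0.
rewrite -{1}[j]add0n big_addn big_mkord mulr_sumr; apply: eq_bigr => i _.
have natE k : k%:R = real_complex R k%:R by rewrite rmorph_nat.
rewrite addnK !cofrE -[l ^+ i *+ _]mulr_natr exprMn -rmorphXn !natE.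
have fN0 (k : nat) : (k`!%:R : R) != 0 by rewrite pnatr_eq0 -lt0n fact_gt0.
rewrite [l ^+ i * _]mulrC -mulrA -fmorphV [l ^+ i * _]mulrC !mulrA -!rmorphM.
congr (real_complex R _ * _).
have -> : ((i + j)`!%:R : R) = ('C(i + j, j) * (j`! * i`!))%N%:R.
  by rewrite -[in i`!](addnK j i) bin_fact ?leq_addl.
have bN0 : ('C(i + j, j)%:R : R) != 0.
  by rewrite pnatr_eq0 -lt0n bin_gt0 leq_addl.
rewrite !natrM exprD; field.
by rewrite !fN0 bN0.
Qed.

Lemma expm_partial_mul (t : R) A l v m K : (A - l%:M) ^+ m *m v = 0 ->
  expm_partial t A K *m v =
  \sum_(j < m) (cofr (t ^+ j / j`!%:R) * expsum (l * cofr t) (K - j)) *: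
     ((A - l%:M) ^+ j *m v).
Proof.
move=> Av; rewrite /expm_partial mulmx_suml.
under eq_bigr => k _ do
  rewrite -scalemxAl (exprn_mul_shift k Av) scaler_sumr.
rewrite exchange_big; apply: eq_bigr => j _ /=.
by under eq_bigr => k _ do rewrite scalerA; rewrite -scaler_suml expsum_bin.
Qed.

Lemma expm_eq (t : R) A E :
  (forall i j, ccvg (fun K => expm_partial t A K i j) (E i j)) -> expm t A = E.
Proof.
move=> AE; apply/matrixP => i j; rewrite mxE.
have [/(cvg_lim (@Rhausdorff R)) -> /(cvg_lim (@Rhausdorff R)) ->] := AE i j.
by case: (E i j).
Qed.

(** The partial sums times [V] converge to the matrix [W] of the claimed columns; multiplying by
    [invmx V] gives the limit [W *m invmx V] of the partial sums themselves. *)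
Lemma expm_mul_basis (t : R) A V (lam : 'I_n -> R[i]) m :
  V \in unitmx -> (forall c, (A - (lam c)%:M) ^+ m *m col c V = 0) ->
  forall c, expm t A *m col c V =
    \sum_(j < m) (cofr (t ^+ j / j`!%:R) * cexp (lam c * cofr t)) *:
       ((A - (lam c)%:M) ^+ j *m col c V).
Proof.
move=> Vu Av c.
pose w c := \sum_(j < m) (cofr (t ^+ j / j`!%:R) * cexp (lam c * cofr t)) *:
       ((A - (lam c)%:M) ^+ j *m col c V).
pose W := \matrix_(i, c) w c i 0.
have cW i c' : ccvg (fun K => (expm_partial t A K *m col c' V) i 0) (W i c').
  under [X in ccvg X]funext => K do rewrite (expm_partial_mul t K (Av c')) summxE.
  rewrite mxE /w summxE; apply: ccvg_sum => j.
  under [X in ccvg X]funext => K do rewrite mxE.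
  rewrite [X in ccvg _ X]mxE; apply: ccvgM; last exact: ccvg_cst.
  apply: ccvgM; first exact: ccvg_cst.
  by apply: (ccvg_shift j); exact: cvg_expsum_complex.
have -> : expm t A = W *m invmx V.
  apply: expm_eq => i j.
  under [X in ccvg X]funext => K do rewrite -[expm_partial _ _ _](mulmxK Vu) mxE.
  rewrite [X in ccvg _ X]mxE; apply: ccvg_sum => c'; apply: ccvgM; last exact: ccvg_cst.
  have := cW i c'; congr ccvg; apply/funext => K.
  by rewrite colE mulmxA -colE mxE.
have -> : W *m invmx V *m col c V = col c W by rewrite !colE mulmxA mulmxKV.
by apply/colP => i; rewrite !mxE.
Qed.

End MatrixExponential.

(** * Norms on complex vectors and the induced operator norm *)

Section VectorNorms.
Variables (R : realType) (n : nat) (N : 'cV[R[i]]_n -> R).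
Hypothesis NN : is_vnorm N.
Implicit Types (x y u z : 'cV[R[i]]_n) (M : 'M[R[i]]_n).

Lemma vnorm_ge0 x : 0 <= N x.
Proof. by case: NN => + _ _ _; apply. Qed.

Lemma vnormZ a x : N (a *: x) = cabs a * N x.
Proof. by case: NN => _ _ + _; apply. Qed.

Lemma vnormD x y : N (x + y) <= N x + N y.
Proof. by case: NN => _ _ _; apply. Qed.

Lemma vnorm0 : N 0 = 0.
Proof. by rewrite -(scale0r 0) vnormZ cabs0 mul0r. Qed.

Lemma vnorm_eq0 x : (N x == 0) = (x == 0).
Proof.
by apply/eqP/eqP => [|->]; [case: NN => _ + _ _; apply|exact: vnorm0].
Qed.

Lemma vnormN x : N (- x) = N x.
Proof. by rewrite -scaleN1r vnormZ cabsN cabs1 mul1r. Qed.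

Lemma vnorm_dist x y : `|N x - N y| <= N (x - y).
Proof.
have h u v : N u - N v <= N (u - v).
  by rewrite lerBlDr (le_trans _ (vnormD _ _)) // subrK.
by rewrite ler_norml h lerNl opprB -(vnormN (x - y)) opprB h.
Qed.

Lemma vnorm_sum I (r : seq I) (P : pred I) (F : I -> 'cV[R[i]]_n) :
  N (\sum_(i <- r | P i) F i) <= \sum_(i <- r | P i) N (F i).
Proof.
elim/big_ind2: _ => [|x a y b ha hb|//]; first by rewrite vnorm0.
by rewrite (le_trans (vnormD _ _)) // lerD.
Qed.

Lemma vnorm_mulmx M u :
  N (M *m u) <= \sum_j cabs (u j 0) * N (col j M).
Proof.
have -> : M *m u = \sum_j u j 0 *: col j M.
  apply/colP => i; rewrite mxE summxE; apply: eq_bigr => j _.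
  by rewrite !mxE mulrC.
by apply: le_trans (vnorm_sum _ _ _) _; apply: ler_sum => j _; rewrite vnormZ.
Qed.

(** Identifies complex [n]-space with real [2n]-space, where the extreme value theorem on the
    compact unit sphere is applied. *)
Definition cV_of_rV (v : 'rV[R]_(n + n)) : 'cV[R[i]]_n :=
  \col_i Complex (v 0 (lshift n i)) (v 0 (rshift n i)).

Lemma cV_of_rVB v w : cV_of_rV (v - w) = cV_of_rV v - cV_of_rV w.
Proof. by apply/colP => i; rewrite !mxE. Qed.

Lemma cV_of_rVZ (a : R) v : cV_of_rV (a *: v) = cofr a *: cV_of_rV v.
Proof.
apply/colP => i; rewrite !mxE; apply/eqP.
by rewrite eq_complex /= !mul0r subr0 addr0 !eqxx.
Qed.

Lemma cV_of_rV_surj x : exists v, x = cV_of_rV v.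
Proof.
exists (row_mx (\row_i complex.Re (x i 0)) (\row_i complex.Im (x i 0))).
by apply/colP => i; rewrite [RHS]mxE row_mxEl row_mxEr !mxE; case: (x i 0).
Qed.

Lemma cV_of_rV_eq0 v : cV_of_rV v = 0 -> v = 0.
Proof.
move=> /colP v0; apply/rowP => k; rewrite mxE.
by case: (split_ordP k) => i ->; have /eqP := v0 i;
  rewrite !mxE eq_complex => /andP[/eqP + /eqP +].
Qed.

Lemma ler_mx_norm m p (v : 'M[R]_(m, p)) i j : `|v i j| <= `|v|.
Proof.
rewrite [leRHS]/Num.norm /= mx_normrE.
by apply/bigmax_geP; right => /=; exists (i, j).
Qed.

Lemma cabs_cV_of_rV v i : cabs (cV_of_rV v i 0) <= 2 * `|v|.
Proof.
have -> : cV_of_rV v i 0 =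
    cofr (v 0 (lshift n i)) + Complex 0 1 * cofr (v 0 (rshift n i)).
  by rewrite mxE [LHS]complexE.
rewrite (le_trans (cabsD _ _)) // cabsM !cabs_cofr /cabs /=.
rewrite expr0n expr1n add0r sqrtr1 mul1r mulr_natl mulr2n.
by rewrite lerD // ler_mx_norm.
Qed.

Lemma cV_of_rV_continuous : continuous (N \o cV_of_rV).
Proof.
(* A Lipschitz constant; the [+ 1] makes it positive, for the radius [e / L]. *)
pose L := \sum_j 2 * N (col j 1%:M) + 1.
have L0 : 0 < L.
  rewrite ltr_wpDl // sumr_ge0 // => j _.
  by rewrite mulr_ge0 // vnorm_ge0.
move=> v; apply/(@cvgrPdist_lt _ _ _ _ (nbhs_filter v)) => e e0.
have := @nbhsx_ballx _ _ v (e / L) (divr_gt0 e0 L0).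
apply: filterS => w; rewrite -ball_normE /= ltr_pdivlMr //; apply: le_lt_trans.
rewrite (le_trans (vnorm_dist _ _)) // -cV_of_rVB.
rewrite -[cV_of_rV _]mul1mx (le_trans (vnorm_mulmx _ _)) //.
rewrite mulrDr mulr_sumr ler_wpDr // ?mulr_ge0 ?ler_sum // => j _.
by rewrite mulrA ler_wpM2r ?vnorm_ge0 // mulrC cabs_cV_of_rV.
Qed.

(* N attains a positive minimum on the unit sphere of the real space
   underlying 'cV[R[i]]_n, which is compact. *)
Lemma coord_le_vnorm : exists C : R, 0 <= C /\ forall x i, cabs (x i 0) <= C * N x.
Proof.
case: (posnP n) => [n0|n0].
  by exists 0; split=> // x i; have := ltn_ord i; rewrite [in X in (_ < X)%N]n0.
pose S := [set v : 'rV[R]_(n + n) | `|v| = 1].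
have S0 : S !=set0.
  pose v : 'rV[R]_(n + n) := const_mx 1.
  have v0 : v != 0.
    apply/eqP => /rowP /(_ (lshift n (Ordinal n0))); rewrite !mxE.
    by apply/eqP; exact: oner_neq0.
  exists (`|v|^-1 *: v); rewrite /S /= normrZ normfV normr_id mulVf //.
  by rewrite normr_eq0.
have Scpt : compact S.
  apply: bounded_closed_compact.
    by exists 1; split => // r r1 v /= ->; exact: ltW.
  have := @preimage_closed _ _ (fun v : 'rV[R]_(n + n) => `|v|) [set x : R | x = 1].
  by apply => [v _|]; [exact: norm_continuous|exact: closed_eq].
have [c cS cmin] := EVT_min_rV S0 Scpt
  (continuous_subspaceT (cV_of_rV_continuous)).
have Nc : 0 < N (cV_of_rV c).
  rewrite lt_neqAle vnorm_ge0 andbT eq_sym vnorm_eq0; apply/eqP => /cV_of_rV_eq0 c0.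
  by move: cS; rewrite inE /S /= c0 normr0 => /esym/eqP; rewrite oner_eq0.
(* The 2 comes from [cabs_cV_of_rV]; homogeneity carries the minimum at [c] over to all vectors. *)
exists (2 / N (cV_of_rV c)); split; first by rewrite divr_ge0 // ltW.
move=> x i; have [v ->] := cV_of_rV_surj x.
apply: le_trans (cabs_cV_of_rV v i) _.
rewrite -mulrA ler_wpM2l // mulrC ler_pdivlMr //.
have [->|v0] := eqVneq v 0; first by rewrite normr0 mul0r vnorm_ge0.
have nv : 0 < `|v| by rewrite normr_gt0.
have := cmin (`|v|^-1 *: v).
rewrite inE /S /= normrZ normfV normr_id mulVf ?gt_eqF // => /(_ erefl).
rewrite cV_of_rVZ vnormZ cabs_cofr ger0_norm ?invr_ge0 //.
by rewrite mulrC ler_pdivlMr // mulrC.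
Qed.

Lemma mulmx_bounded M : exists C : R, 0 <= C /\ forall u, N (M *m u) <= C * N u.
Proof.
have [C [C0 hC]] := coord_le_vnorm.
exists (\sum_j C * N (col j M)); split.
  by apply: sumr_ge0 => j _; rewrite mulr_ge0 // vnorm_ge0.
move=> u; apply: le_trans (vnorm_mulmx _ _) _.
rewrite mulr_suml; apply: ler_sum => j _.
by rewrite mulrAC ler_wpM2r // vnorm_ge0.
Qed.

(** [mulmx_bounded] bounds the set of values, so that its [sup] is an upper bound. *)
Lemma le_opnorm M z : N z = 1 -> N (M *m z) <= opnorm N M.
Proof.
move=> z1; apply: ub_le_sup; last by exists z.
have [C [_ hC]] := mulmx_bounded M.
by exists C => _ [u /= u1 <-]; rewrite (le_trans (hC u)) // u1 mulr1.
Qed.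

Lemma opnorm_le M z (c : R) : N z = 1 ->
  (forall u, N u = 1 -> N (M *m u) <= c) -> opnorm N M <= c.
Proof.
move=> z1 hc; apply: ge_sup; first by exists (N (M *m z)), z.
by move=> _ [u /= u1 <-]; exact: hc.
Qed.

Lemma opnorm_dist M M' z (e : R) : N z = 1 ->
  (forall u, N u = 1 -> N (M *m u - M' *m u) <= e) ->
  `|opnorm N M - opnorm N M'| <= e.
Proof.
move=> z1 he.
have h M1 M2 : (forall u, N u = 1 -> N (M1 *m u - M2 *m u) <= e) ->
    opnorm N M1 - opnorm N M2 <= e.
  move=> h12; rewrite lerBlDr; apply: (opnorm_le z1) => u u1.
  rewrite -[M1 *m u](subrK (M2 *m u)) (le_trans (vnormD _ _)) //.
  by rewrite lerD ?h12 ?le_opnorm.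
rewrite ler_norml h // andbT lerNl opprB h // => u u1.
by rewrite -vnormN opprB he.
Qed.

(** The inequality [<=] holds for every scalar; for [a != 0] the reverse is the same one applied to
    [a^-1] and [a *: M]. *)
Lemma opnormZ a M z : N z = 1 -> opnorm N (a *: M) = cabs a * opnorm N M.
Proof.
move=> z1; have h b M' : opnorm N (b *: M') <= cabs b * opnorm N M'.
  apply: (opnorm_le z1) => u u1.
  by rewrite -scalemxAl vnormZ ler_wpM2l ?cabs_ge0 // le_opnorm.
apply/eqP; rewrite eq_le h /=.
have [->|a0] := eqVneq a 0.
  rewrite cabs0 mul0r; apply: le_trans (vnorm_ge0 _) (le_opnorm _ z1).
rewrite -[in leLHS](scalerK a0 M) -ler_pdivlMl.
  by rewrite -cabsV h.
by rewrite lt_neqAle eq_sym cabs_eq0 a0 cabs_ge0.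
Qed.

End VectorNorms.

(** * Growth of [t^m e^(rt)], compared up to a factor of order [1/t] *)

Definition bigO_div {R : realType} (s f : R -> R) : Prop :=
  exists K : R, forall t, 1 <= t -> f t <= s t * (K / t).

Section Growth.
Variable R : realType.
Implicit Types (s f g : R -> R) (a r : R).

Lemma bigO_div_le s f g : (forall t, 1 <= t -> f t <= g t) ->
  bigO_div s g -> bigO_div s f.
Proof. by move=> fg [K hK]; exists K => t t1; rewrite (le_trans (fg _ t1)) // hK. Qed.

Lemma bigO_div0 s : bigO_div s (fun=> 0).
Proof. by exists 0 => t _; rewrite mul0r mulr0. Qed.

Lemma bigO_divZ s f (k : R) : 0 <= k -> bigO_div s f -> bigO_div s (fun t => k * f t).
Proof.
move=> k0 [K hK]; exists (k * K) => t t1.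
by rewrite -mulrA mulrCA ler_wpM2l // hK.
Qed.

Lemma bigO_div_sum s I (l : seq I) (f : I -> R -> R) :
  (forall i, bigO_div s (f i)) -> bigO_div s (fun t => \sum_(i <- l) f i t).
Proof.
move=> h; elim: l => [|i l [K hK]].
  by apply: bigO_div_le (bigO_div0 s) => t _; rewrite big_nil.
have [K' hK'] := h i; exists (K' + K) => t t1.
by rewrite big_cons mulrDl mulrDr lerD ?hK ?hK'.
Qed.

(** For [m = M_1 - 1] and [r] the maximal real part this is the scale [s(t)]; with [r] the real part
    of [lam c] it is the modulus of the coefficient of [(A - lam c)^m] in the expansion of
    [expm t A *m col c V]. *)
Definition growth (m : nat) (r t : R) : R := t ^+ m / m`!%:R * expR (r * t).

Lemma growth_gt0 m r t : 1 <= t -> 0 < growth m r t.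
Proof.
move=> t1; have t0 : 0 < t by exact: lt_le_trans t1.
by rewrite mulr_gt0 ?expR_gt0 // divr_gt0 ?exprn_gt0 // ltr0n fact_gt0.
Qed.

Lemma fact_gt0R (k : nat) : 0 < k`!%:R :> R.
Proof. by rewrite ltr0n fact_gt0. Qed.

(** The gap [d = r - a] gives [e^(dt) >= (dt)^(j+1) / (j+1)!], which absorbs [t^j] and leaves a
    factor [1/t]. *)
Lemma growth_lt_exponent j m a r : a < r -> bigO_div (growth m r) (growth j a).
Proof.
rewrite -subr_gt0 => d0; set d := r - a in d0.
(* The first quotient exchanges the factorials of the two growth terms, the second inverts the lower
   bound for [expR (d * t)]. *)
exists (m`!%:R / j`!%:R * (j.+1`!%:R / d ^+ j.+1)) => t t1.
have t0 : 0 < t by exact: lt_le_trans t1.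
rewrite /growth (_ : r * t = a * t + d * t); last by rewrite -mulrDl addrC subrK.
have h : t ^+ j.+1 * d ^+ j.+1 / j.+1`!%:R <= expR (d * t).
  rewrite -exprMn [t * d]mulrC; apply: le_trans (expR_ge1Dxn j _).
    by rewrite ler_wpDl.
  by rewrite mulr_ge0 // ltW.
have tm : 1 <= t ^+ m by exact: exprn_ege1.
rewrite expRD.
apply: (@le_trans _ _ (t ^+ m / m`!%:R *
  (expR (a * t) * (t ^+ j.+1 * d ^+ j.+1 / j.+1`!%:R)) *
  (m`!%:R / j`!%:R * (j.+1`!%:R / d ^+ j.+1) / t))).
  rewrite [leRHS](_ : _ = t ^+ m * (t ^+ j / j`!%:R * expR (a * t))).
    by rewrite ler_peMl // mulr_ge0 ?expR_ge0 // divr_ge0 ?exprn_ge0 // ltW.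
  rewrite exprS; field.
  by rewrite expf_neq0 !gt_eqF ?fact_gt0R.
rewrite ler_wpM2r ?ler_wpM2l ?expR_ge0 //.
  by rewrite !(mulr_ge0, divr_ge0, invr_ge0, exprn_ge0) // ltW.
by rewrite divr_ge0 ?exprn_ge0 // ltW.
Qed.

Lemma growth_lt_degree j m r : (j < m)%N -> bigO_div (growth m r) (growth j r).
Proof.
move=> jm; exists (m`!%:R / j`!%:R) => t t1.
have t0 : 0 < t by exact: lt_le_trans t1.
rewrite /growth [leRHS](_ : _ = (t ^+ m.-1 / j`!%:R) * expR (r * t)).
  rewrite ler_wpM2r ?expR_ge0 // ler_wpM2r ?invr_ge0 // ler_weXn2l //.
  by case: m jm.
case: m jm => // m _; rewrite [m.+1.-1]/= exprS; field.
by rewrite !gt_eqF ?fact_gt0R.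
Qed.

(** The hypotheses give [|f / g - 1| <= K / (d t)]. *)
Lemma cvg_ratio1 (f g : R -> R) (K d : R) : 0 < d ->
  (forall t, 1 <= t -> `|f t - g t| <= K / t) ->
  (forall t, 1 <= t -> d <= g t) ->
  (f t / g t) @[t --> +oo] --> (1 : R).
Proof.
move=> d0 fg dg; apply/cvgrPdist_le => e e0; near=> t.
have t1 : 1 <= t by near: t; apply: nbhs_pinfty_ge; exact: num_real.
have t0 : 0 < t by exact: lt_le_trans t1.
have gt0 : 0 < g t by rewrite (lt_le_trans d0) ?dg.
rewrite -[X in X - _](divff (lt0r_neq0 gt0)) -mulrBl normrM normfV distrC.
rewrite [`|g t|]ger0_norm ?(ltW gt0) // ler_pdivrMr // (le_trans (fg _ t1)) //.
rewrite ler_pdivrMr // (@le_trans _ _ (e * d * t)) //; last first.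
  by rewrite ler_wpM2r ?(ltW t0) // ler_wpM2l ?(ltW e0) ?dg.
rewrite mulrC -ler_pdivrMr ?mulr_gt0 //.
Unshelve. all: by end_near. Qed.

End Growth.

(** * Asymptotics of the exponential in a Jordan basis *)

Section JordanAsymptotics.
Variables (R : realType) (n : nat) (A V : 'M[R[i]]_n).
Variables (lam : 'I_n -> R[i]) (ch : 'I_n -> 'I_n) (pos : 'I_n -> nat).
Hypothesis JB : is_jordan_basis A V lam ch pos.

Local Notation top := (top_col lam ch pos).
Local Notation head := (chain_head ch pos).
Local Notation B c := (A - (lam c)%:M).

(** Each position occurs at most once in a chain, so [pick] returns [h] and the default is not
    reached. *)
Lemma chain_headP c h : ch h = ch c -> pos h = 1%N -> head c = h.
Proof.
case: JB => _ _ _ inj _ hc h1; rewrite /chain_head; case: pickP => [c'|/(_ h)].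
  by case/andP=> /eqP e /eqP p; apply: inj; rewrite ?e ?p.
by rewrite hc h1 !eqxx.
Qed.

(** Each factor moves one place down the chain: [p] factors lead from position [p.+1] to the head,
    and one more gives 0. *)
Lemma chain_descent p c : pos c = p.+1 ->
  [/\ ch (head c) = ch c, pos (head c) = 1%N,
      B c ^+ p *m col c V = col (head c) V & B c ^+ p.+1 *m col c V = 0].
Proof.
case: (JB) => _ lamE _ _ step.
elim: p c => [|p IH] c pc.
  have hc : head c = c by exact: chain_headP.
  by have := step c; rewrite hc pc eqxx expr0 expr1 mul1mx => ->.
have := step c; rewrite pc /= => -[c' [chc' pc' Bc]].
have [h1 h2 h3 h4] := IH c' pc'.
have hc : head c = head c' by apply: chain_headP; rewrite ?h1.
rewrite -(lamE _ _ chc') in Bc *.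
by rewrite hc h1 h2 exprSr -mulmxE -mulmxA Bc h3 exprSr -mulmxE -mulmxA Bc h4.
Qed.

Lemma pos_gt0 c : (0 < pos c)%N.
Proof. by case: JB => _ _ /(_ c) /andP[]. Qed.

Lemma pos_prednK c : pos c = (pos c).-1.+1.
Proof. by rewrite prednK // pos_gt0. Qed.

Lemma shift_pos_vanish c j : (pos c <= j)%N -> B c ^+ j *m col c V = 0.
Proof.
move=> pj; have [_ _ _] := chain_descent (pos_prednK c).
rewrite -pos_prednK => Bp.
by rewrite -(subnK pj) exprD -mulmxE -mulmxA Bp mulmx0.
Qed.

Lemma pos_le_dim c : (pos c <= n)%N.
Proof.
case: JB => _ _ /(_ c) /andP[_ pc] _ _; apply: leq_trans pc _.
by rewrite /chain_len -[X in (_ <= X)%N]card_ord max_card.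
Qed.

(** Positions are at most [n], so the exponent [n] kills every column and one range of [j] serves
    all chains. *)
Lemma expm_col t c : expm t A *m col c V =
  \sum_(j < n) (cofr (t ^+ j / j`!%:R) * cexp (lam c * cofr t)) *:
       (B c ^+ j *m col c V).
Proof.
case: (JB) => Vu _ _ _ _; apply: (expm_mul_basis t Vu) => c'.
by rewrite shift_pos_vanish ?pos_le_dim.
Qed.

(** A head determines its chain, which has only one column in position [M_1]. *)
Lemma top_head_inj c c' : top c -> top c' -> head c = head c' -> c = c'.
Proof.
move=> /and3P[_ _ /eqP pc] /and3P[_ _ /eqP pc'] hh; case: (JB) => _ _ _ inj _.
have [h1 _ _ _] := chain_descent (pos_prednK c).
have [h1' _ _ _] := chain_descent (pos_prednK c').
by apply: inj; rewrite ?pc ?pc' // -h1 hh h1'.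
Qed.

Definition coordV (u : 'cV[R[i]]_n) c : R[i] := (invmx V *m u) c 0.

Lemma basis_expansion u : u = \sum_c coordV u c *: col c V.
Proof.
case: JB => Vu _ _ _ _; apply/colP => i.
rewrite -{1}(mulKVmx Vu u) mxE summxE; apply: eq_bigr => c _.
by rewrite [RHS]mxE [X in _ = _ * X]mxE mulrC.
Qed.

Lemma row_mul_coordV u c : row c (invmx V) *m u = (coordV u c)%:M.
Proof.
apply/matrixP => i j; rewrite !ord1 /coordV -row_mul !mxE eqxx mulr1n.
by apply: eq_bigr => k _; rewrite ?mxE.
Qed.

(** The image of [col c V] under [Q1]: what remains of [expm t A *m col c V] after division by
    [s(t)], up to [O(1/t)]. *)
Definition dominant t c : 'cV[R[i]]_n :=
  if top c then cexpi (complex.Im (lam c) * t) *: col (head c) V else 0.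

Lemma Q1_mul t u :
  Q1 V lam ch pos t *m u = \sum_c coordV u c *: dominant t c.
Proof.
rewrite /Q1 mulmx_suml big_mkcond; apply: eq_bigr => c _.
rewrite /dominant; case: ifP => _; last by rewrite scaler0.
rewrite -scalemxAl -mulmxA row_mul_coordV mul_mx_scalar scalerA.
by rewrite scalerA mulrC.
Qed.

Lemma coordV_col c h : coordV (col h V) c = (c == h)%:R.
Proof.
case: JB => Vu _ _ _ _; rewrite /coordV colE mulmxA mulVmx // mul1mx.
by rewrite !mxE eqxx andbT.
Qed.

(** Distinct top columns have distinct heads, so only the term of [c] contributes along [head c]. *)
Lemma coordV_Q1 t u c : top c ->
  coordV (Q1 V lam ch pos t *m u) (head c) =
  coordV u c * cexpi (complex.Im (lam c) * t).
Proof.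
move=> tc; rewrite Q1_mul /coordV mulmx_sumr summxE (bigD1 c) //=.
rewrite big1 ?addr0 => [|c' c'c]; rewrite -scalemxAr mxE -/(coordV _ _).
  by rewrite /dominant tc -scalemxAr mxE -/(coordV _ _) coordV_col eqxx mulr1.
rewrite /dominant; case: ifP => tc'; last by rewrite mulmx0 mxE mulr0.
rewrite -scalemxAr mxE -/(coordV _ _) coordV_col.
case: eqP => [/(top_head_inj tc tc') e|]; last by rewrite !mulr0.
by rewrite e eqxx in c'c.
Qed.

Lemma cabs_exp_coef (t : R) c j : 0 <= t ->
  cabs (cofr (t ^+ j / j`!%:R) * cexp (lam c * cofr t)) =
  growth j (complex.Re (lam c)) t.
Proof.
move=> t0; rewrite !cabsM !cabs_cofr cabs_cexpi mulr1 !ger0_norm ?expR_ge0 //.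
  by rewrite complex_ReM /= mulr0 subr0.
by rewrite divr_ge0 // exprn_ge0.
Qed.

Variable N : 'cV[R[i]]_n -> R.
Hypothesis NN : is_vnorm N.

Lemma coordV_bound : exists C : R, 0 <= C /\ forall u c, cabs (coordV u c) <= C * N u.
Proof.
have [C [C0 hC]] := coord_le_vnorm NN.
have [C' [C'0 hC']] := mulmx_bounded NN (invmx V).
exists (C * C'); split; first exact: mulr_ge0.
by move=> u c; rewrite (le_trans (hC _ _)) // -mulrA ler_wpM2l.
Qed.

Lemma Q1_lower_bound u : RLGE V lam ch pos u ->
  exists d : R, 0 < d /\ forall t, d <= N (Q1 V lam ch pos t *m u).
Proof.
move=> [c [tc uc]]; have [C [C0 hC]] := coordV_bound.
have a0 : 0 < cabs (coordV u c).
  rewrite lt_neqAle cabs_ge0 andbT eq_sym cabs_eq0; apply: contra uc => /eqP uc.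
  by rewrite row_mul_coordV uc raddf0.
(* [C] may be 0, hence the divisor [C + 1]. *)
exists (cabs (coordV u c) / (C + 1)); split.
  by rewrite divr_gt0 // ltr_wpDl.
move=> t; rewrite ler_pdivrMr ?ltr_wpDl //.
rewrite -[leLHS]mulr1 -(cabs_cexpi (complex.Im (lam c) * t)) -cabsM -coordV_Q1 //.
by rewrite (le_trans (hC _ _)) // mulrC ler_wpM2l ?vnorm_ge0 // lerDl cabs_ge0.
Qed.

(** The column [c0] serves to name the scale: [(pos c0).-1] is [M_1 - 1], and [lam c0] has maximal
    real part. *)
Lemma expm_col_asymptotics c0 c : top c0 ->
  bigO_div (growth (pos c0).-1 (complex.Re (lam c0)))
    (fun t => N (expm t A *m col c V -
       cofr (growth (pos c0).-1 (complex.Re (lam c0)) t) *: dominant t c)).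
Proof.
set s := growth _ _; move=> tc0.
have /and3P[/forallP L0 _ /eqP pc0] := tc0.
(* [main] marks the term that [dominant] cancels exactly; [f] bounds the others, those with
   [j >= pos c] being zero. *)
pose main j := top c && (j == (pos c).-1)%N.
pose f (j : 'I_n) t := if (j < pos c)%N && ~~ main j
  then N (B c ^+ j *m col c V) * growth j (complex.Re (lam c)) t else 0.
apply: (@bigO_div_le _ _ _ (fun t => \sum_j f j t)); last first.
  apply: bigO_div_sum => j; rewrite /f.
  case: (boolP ((j < pos c)%N && ~~ main j)) => [/andP[jc mj]|_]; last exact: bigO_div0.
  apply: bigO_divZ; first exact: vnorm_ge0.
  (* A smaller real part leaves an exponential gap; for an equal one, [j < M_1 - 1] has to be
     shown. *)
  have := L0 c; rewrite le_eqVlt => /orP[/eqP Re_c|]; last first.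
    exact: growth_lt_exponent.
  rewrite /s Re_c; apply: growth_lt_degree.
  have Lc : inL1 lam c by apply/forallP => c'; rewrite Re_c.
  have lenc : (chain_len ch c <= M1 lam ch)%N.
    by rewrite /M1 (bigD1 c) //= leq_maxl.
  have posc : (pos c <= chain_len ch c)%N by case: JB => _ _ /(_ c) /andP[].
  (* From [j < pos c <= M_1], the remaining case [j = M_1 - 1] forces [pos c = M_1]; then [c] is a
     top column and [j] its main term, contradicting [mj]. *)
  have : (j <= (pos c0).-1)%N by rewrite pc0; lia.
  rewrite leq_eqVlt => /orP[/eqP jE|//]; case/negP: mj.
  have pc : pos c = M1 lam ch by have := pos_gt0 c0; lia.
  apply/andP; split; last by rewrite jE pc0 pc.
  by rewrite /top_col Lc pc eqxx andbT /= eqn_leq lenc -pc posc.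
move=> t t1; have t0 : 0 <= t by exact: le_trans t1.
have -> : cofr (s t) *: dominant t c = \sum_(j < n)
    (if main j then (cofr (t ^+ j / j`!%:R) * cexp (lam c * cofr t)) *:
       (B c ^+ j *m col c V) else 0).
  rewrite /dominant /main; case: ifP => [tc|ntc]; last first.
    by rewrite scaler0 big1.
  have pn : ((pos c).-1 < n)%N by rewrite -pos_prednK pos_le_dim.
  rewrite (bigD1 (Ordinal pn)) //= eqxx big1 => [|j /negPf jp]; last first.
    by rewrite -[X in if X then _ else _]/(j == Ordinal pn) jp.
  have [_ _ -> _] := chain_descent (pos_prednK c).
  rewrite addr0 scalerA; congr (_ *: _).
  have /and3P[/forallP Lc _ /eqP pc] := tc.
  rewrite /s /growth /cexp pc0 -pc complex_ReM complex_ImM /= !mulr0 subr0 add0r.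
  have -> : complex.Re (lam c0) = complex.Re (lam c).
    by apply/eqP; rewrite eq_le Lc L0.
  by rewrite !cofrE rmorphM mulrA.
rewrite expm_col -sumrB; apply: le_trans (vnorm_sum NN _ _ _) _.
apply: ler_sum => j _; rewrite /f; case: (main j).
  by rewrite subrr vnorm0 // andbF.
rewrite subr0 andbT (vnormZ NN) cabs_exp_coef // mulrC.
by case: ltnP => // pj; rewrite shift_pos_vanish // vnorm0 // mul0r.
Qed.

(** By linearity the column estimates add up; the coordinates of [u] are at most [C * N u], which
    makes [K] independent of [u]. *)
Lemma expm_asymptotics c0 : top c0 -> exists K : R, 0 <= K /\ forall t u, 1 <= t ->
  N (expm t A *m u - cofr (growth (pos c0).-1 (complex.Re (lam c0)) t) *:
       (Q1 V lam ch pos t *m u)) <=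
  growth (pos c0).-1 (complex.Re (lam c0)) t * (K / t * N u).
Proof.
set s := growth _ _ => tc0.
have [C [C0 hC]] := coordV_bound.
have [K hK] : bigO_div s (fun t => \sum_c C * N (expm t A *m col c V -
       cofr (s t) *: dominant t c)).
  by apply: bigO_div_sum => c; apply: bigO_divZ => //; exact: expm_col_asymptotics.
(* [bigO_div] fixes no sign for its constant. *)
exists `|K|; split=> // t u t1.
have t0 : 0 < t by exact: lt_le_trans t1.
rewrite mulrA; apply: (@le_trans _ _ (s t * (K / t) * N u)); last first.
  rewrite ler_wpM2r ?vnorm_ge0 // ler_wpM2l ?(ltW (growth_gt0 _ _ t1)) //.
  by rewrite ler_wpM2r ?ler_norm // invr_ge0 ltW.
apply: le_trans (ler_wpM2r (vnorm_ge0 NN u) (hK t t1)).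
rewrite {1}[u]basis_expansion mulmx_sumr Q1_mul scaler_sumr -sumrB mulr_suml.
apply: le_trans (vnorm_sum NN _ _ _) _; apply: ler_sum => c _.
rewrite -scalemxAr scalerA mulrC -scalerA -scalerBr (vnormZ NN) [leRHS]mulrAC.
by rewrite ler_wpM2r ?vnorm_ge0.
Qed.

End JordanAsymptotics.

(** * Quotients of equivalents, and the two condition numbers *)

Lemma asym_equiv_div (R : realType) (s p q a b : R -> R) :
  (forall t, 1 <= t -> s t != 0) ->
  asym_equiv (fun t => p t / s t) a -> asym_equiv (fun t => q t / s t) b ->
  asym_equiv (fun t => p t / q t) (fun t => a t / b t).
Proof.
move=> s0 pa qb; rewrite /asym_equiv.
have h : (p t / s t / a t) * (q t / s t / b t)^-1 @[t --> +oo] --> (1 : R).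
  by rewrite -[X in _ --> X]mulr1 -{2}invr1; apply: cvgM pa (cvgV (oner_neq0 R) qb).
move: h; apply: cvg_trans; apply: near_eq_cvg; near=> t.
have st : s t != 0 by apply: s0; near: t; apply: nbhs_pinfty_ge; exact: num_real.
rewrite !invfM !invrK.
rewrite (_ : _ * _ = p t / a t * ((q t)^-1 * b t) * ((s t)^-1 * s t)); last by ring.
by rewrite mulVf // mulr1; ring.
Unshelve. all: by end_near. Qed.

Theorem theorem5 (R : realType) (n : nat) (A : 'M[R[i]]_n)
  (N : 'cV[R[i]]_n -> R)
  (V : 'M[R[i]]_n) (lam : 'I_n -> R[i]) (ch : 'I_n -> 'I_n)
  (pos : 'I_n -> nat) (y0 z0 : 'cV[R[i]]_n) :
  is_vnorm N ->
  is_jordan_basis A V lam ch pos ->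
  y0 != 0 -> N z0 = 1 ->
  RLGE V lam ch pos y0 -> RLGE V lam ch pos z0 ->
  asym_equiv (Kdir N A y0 z0)
    (fun t => N (Q1 V lam ch pos t *m z0)
              / N (Q1 V lam ch pos t *m nrmlz N y0))
  /\
  asym_equiv (Kcond N A y0)
    (fun t => opnorm N (Q1 V lam ch pos t)
              / N (Q1 V lam ch pos t *m nrmlz N y0)).
Proof.
move=> NN JB y00 z01 hy hz.
(* Normalizing multiplies each coordinate by a nonzero scalar. *)
have hyhat : RLGE V lam ch pos (nrmlz N y0).
  case: hy => c [tc uc]; exists c; split => //.
  rewrite /nrmlz -scalemxAr scaler_eq0 negb_or uc andbT.
  by rewrite -cabs_eq0 cabs_cofr normr_eq0 invr_eq0 vnorm_eq0.
have [c0 [tc0 _]] := hz.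
have [K [K0 hK]] := expm_asymptotics JB NN tc0.
set s := growth _ _ in hK.
have s_gt0 t : 1 <= t -> 0 < s t by exact: growth_gt0.
have s_neq0 t : 1 <= t -> s t != 0 by move=> /s_gt0/lt0r_neq0.
have sQ t u : 1 <= t -> s t * N (Q1 V lam ch pos t *m u) =
    N (cofr (s t) *: (Q1 V lam ch pos t *m u)).
  by move=> t1; rewrite (vnormZ NN) cabs_cofr gtr0_norm ?s_gt0.
have divs (x y e : R) t : 1 <= t -> `|x - s t * y| <= s t * e -> `|x / s t - y| <= e.
  move=> t1; rewrite -[in s t * e](gtr0_norm (s_gt0 t t1)).
  rewrite -ler_pdivrMl ?normr_gt0 ?s_neq0 //.
  by rewrite -normfV -normrM mulrBr mulKf ?s_neq0 // mulrC.
have vec_equiv u : RLGE V lam ch pos u ->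
    asym_equiv (fun t => N (expm t A *m u) / s t) (fun t => N (Q1 V lam ch pos t *m u)).
  move=> hu; have [d [d0 hd]] := Q1_lower_bound JB NN hu.
  apply: (@cvg_ratio1 _ _ _ (K * N u) d) => // t t1; apply: divs => //.
  by rewrite sQ // [K * N u / t]mulrAC (le_trans (vnorm_dist NN _ _)) // hK.
split; first exact: asym_equiv_div (vec_equiv _ hz) (vec_equiv _ hyhat).
apply: asym_equiv_div (vec_equiv _ hyhat) => //.
(* The unit vector [z0] satisfies RLGE, so its lower bound [d] is also one for the operator norm of
   [Q1]. *)
have [d [d0 hd]] := Q1_lower_bound JB NN hz.
apply: (@cvg_ratio1 _ _ _ K d) => // t t1; last first.
  by apply: le_trans (hd t) _; exact: le_opnorm.
(* The scale is moved inside the operator norm, where the estimate uniform over unit vectors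
   applies. *)
apply: divs => //; rewrite -[s t in X in `|X|](gtr0_norm (s_gt0 t t1)) -(cabs_cofr (s t)).
rewrite -(opnormZ NN _ _ z01); apply: (opnorm_dist NN z01) => u u1.
by rewrite -scalemxAl (le_trans (hK t u t1)) // u1 mulr1.
Qed.
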